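(* Let $X$ be a real Hausdorff topological vector space, let $C\subseteq X$ be a convex cone with a finite basis $E=\{e_1,\ldots,e_n\}$, and let $L$ be the linear subspace of $X$ spanned by $E$. Let $Y$ be a real finite dimensional Hausdorff topological vector space. If $\varphi:C\rightarrow cc(Y)$ is a lower semicontinuous and $\mathbb{Q}_+$-homogeneous superadditive correspondence, then $\varphi$ is positively homogeneous and $\varphi$ is continuous on $\mathrm{int}_L C$.
   Context: A subset $C$ of a real vector space $X$ is a cone if $tx\in C$ for all $x\in C$, $t>0$; it is a convex cone if it is moreover convex. A (finite) basis of a cone $C$ is a linearly independent (finite) subset $E\subseteq X$ such that $C=\{\sum_{i=1}^n\lambda_i x_i:\lambda_i\ge 0,\ x_i\in E,\ n\in\mathbb{N}\}$. $\mathrm{int}_L C$ denotes the interior of $C$ relative to $L$, with $L$ carrying the subspace topology from $X$. A correspondence $\varphi:C\twoheadrightarrow Y$ is a map assigning to each $x\in C$ a nonempty subset $\varphi(x)\subseteq Y$; $\varphi:C\to cc(Y)$ means that every $\varphi(x)$ is a nonempty convex compact subset of $Y$. The correspondence $\varphi$ is superadditive if $\varphi(x)+\varphi(y)\subseteq\varphi(x+y)$ for all $x,y\in C$; $\mathbb{Q}_+$-homogeneous if $\varphi(rx)=r\varphi(x)$ for all $x\in C$ and all $r\in\mathbb{Q}_+$ (positive rationals); positively homogeneous if $\varphi(tx)=t\varphi(x)$ for all $x\in C$ and all real $t>0$. $\varphi$ is lower semicontinuous at $x$ if for every open $V\subseteq Y$ with $\varphi(x)\cap V\ne\emptyset$ there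 is a neighborhood $U$ of $x$ in $C$ with $\varphi(u)\cap V\neq\emptyset$ for all $u\in U$; upper semicontinuous at $x$ if for every open $V\supseteq\varphi(x)$ there is a neighborhood $U$ of $x$ in $C$ with $\varphi(u)\subseteq V$ for all $u\in U$; continuous at $x$ if both hold. It is lower semicontinuous (resp. continuous) on a set if it is so at each of its points. *)

(* Defs.v *)
From HB Require Import structures.
From mathcomp Require Export all_boot all_order all_algebra.
From mathcomp Require Export boolp classical_sets functions cardinality reals.
From mathcomp Require Export topology convex tvs.

Set Implicit Arguments.
Unset Strict Implicit.
Unset Printing Implicit Defensive.

Import Order.TTheory GRing.Theory Num.Theory.

Local Open Scope classical_set_scope.
Local Open Scope ring_scope.

Section LinearAlgebra.
Context {R : realType} {V : lmodType R}.
Implicit Types (C E : set V).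

(* The combinations below range over finite families of elements of [E]; the
   empty family is allowed, so 0 always belongs to the span and to the
   conical hull. *)

(* The families tested must be injective: [E] is a set, hence has no repeated
   elements. *)
Definition lin_independent E : Prop :=
  forall (m : nat) (v : 'I_m -> V) (c : 'I_m -> R),
    injective v -> (forall i, E (v i)) ->
    \sum_(i < m) c i *: v i = 0 -> forall i, c i = 0.

Definition lin_span E : set V :=
  [set x | exists (m : nat) (v : 'I_m -> V) (c : 'I_m -> R),
     (forall i, E (v i)) /\ x = \sum_(i < m) c i *: v i].

Definition conical_hull E : set V :=
  [set x | exists (m : nat) (v : 'I_m -> V) (c : 'I_m -> R),
     [/\ forall i, E (v i), forall i, 0 <= c i
       & x = \sum_(i < m) c i *: v i]].

Definition is_cone C : Prop :=
  forall (t : R) (x : V), 0 < t -> C x -> C (t *: x).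

Definition is_convex_cone C : Prop := is_cone C /\ convex_set C.

Definition finite_cone_basis E C : Prop :=
  [/\ finite_set E, lin_independent E & C = conical_hull E].

Definition set_scale (t : R) (A : set V) : set V := [set t *: a | a in A].

Definition set_add (A B : set V) : set V :=
  [set a + b | a in A & b in B].

End LinearAlgebra.

Definition finite_dimensional {R : realType} (V : lmodType R) : Prop :=
  exists E : set V,
    [/\ finite_set E, lin_independent E & lin_span E = [set: V]].

(* Points outside [L] are isolated in [subspace L], so this is the interior
   relative to [L] only for [C `<=` L]. *)
Definition rel_interior {X : topologicalType} (L C : set X) : set X :=
  @interior (subspace L) C.

(* A correspondence on [C] is encoded as a total function [X -> set Y] of which
   only the values at points of [C] matter. *)
Section Correspondences.
Context {R : realType} {X Y : topologicalLmodType R}.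
Variables (C : set X) (phi : X -> set Y).

Definition cc_valued : Prop :=
  forall x, C x -> [/\ phi x !=set0, convex_set (phi x) & compact (phi x)].

Definition superadditive : Prop :=
  forall x y, C x -> C y -> set_add (phi x) (phi y) `<=` phi (x + y).

Definition rat_homogeneous : Prop :=
  forall (r : rat) (x : X), 0 < r -> C x ->
    phi (ratr r *: x) = set_scale (ratr r) (phi x).

Definition pos_homogeneous : Prop :=
  forall (t : R) (x : X), 0 < t -> C x ->
    phi (t *: x) = set_scale t (phi x).

(* [within C (nbhs x)] is the filter of neighborhoods of [x] in [C]. *)

Definition corr_lsc_at (x : X) : Prop :=
  forall V : set Y, open V -> phi x `&` V !=set0 ->
    \forall u \near within C (nbhs x), phi u `&` V !=set0.

Definition corr_usc_at (x : X) : Prop :=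
  forall V : set Y, open V -> phi x `<=` V ->
    \forall u \near within C (nbhs x), phi u `<=` V.

Definition corr_continuous_at (x : X) : Prop :=
  corr_lsc_at x /\ corr_usc_at x.

End Correspondences.

(* Main.v *)
(** Lower semicontinuity at [t x], tested along rational multiples of [x], puts
    [phi (t x)] in the closed set [t phi x]; applying this to [1/t] and [t x]
    gives the reverse inclusion. For upper semicontinuity at an interior point
    [x0], fix a small [s > 0]: for [x] near [x0] the point
    [w = x0 + (x0 - x) / s] is still in [C] and [x + s w = (1 + s) x0], so
    [phi x + s phi w `<=` (1 + s) phi x0]. Lower semicontinuity at [x0] provides
    a point of [phi w] near a fixed point of [phi x0], hence [phi x] lies in a
    small perturbation of the compact set [phi x0]. *)
Require Import Defs.

Import Order.TTheory GRing.Theory Num.Theory.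
Import numFieldTopology.Exports.
Local Open Scope classical_set_scope.
Local Open Scope ring_scope.

Section TopologicalLmodule.
Context {R : realType} {V : topologicalLmodType R}.

Lemma tlmod_cvgB {T : Type} {F : set_system T} {FF : Filter F} (f g : T -> V)
    (a b : V) :
  f @ F --> a -> g @ F --> b -> f x - g x @[x --> F] --> a - b.
Proof.
move=> fa gb; have h := @sub_continuous V (a, b).
exact: (@continuous2_cvg _ _ _ _ F FF f g (fun u v => u - v) a b h fa gb).
Qed.

Lemma tlmod_cvgD {T : Type} {F : set_system T} {FF : Filter F} (f g : T -> V)
    (a b : V) :
  f @ F --> a -> g @ F --> b -> f x + g x @[x --> F] --> a + b.
Proof.
move=> fa gb; have h := @add_continuous V (a, b).
exact: (@continuous2_cvg _ _ _ _ F FF f g (fun u v => u + v) a b h fa gb).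
Qed.

Lemma tlmod_cvgZ {T : Type} {F : set_system T} {FF : Filter F} (f : T -> R^o)
    (g : T -> V) (a : R^o) (b : V) :
  f @ F --> a -> g @ F --> b -> f x *: g x @[x --> F] --> a *: b.
Proof.
move=> fa gb; have h := @scale_continuous R V (a, b).
exact: (@continuous2_cvg _ _ _ _ F FF f g (fun u v => u *: v) a b h fa gb).
Qed.

(** For each [a] in [K], [p.1 *: a - p.2] is jointly continuous and nonzero at [(a, (t, y))], and
    [[set 0]] is closed; compactness makes one neighborhood of [(t, y)] serve all [a]. *)
Lemma near_notin_scale_compact (K : set V) (t : R^o) (y : V) :
  hausdorff_space V -> compact K -> ~ set_scale t K y ->
  \forall p \near (t, y), ~ set_scale p.1 K p.2.
Proof.
move=> hV /compact_near_coveringP cK tKy.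
have : \forall p \near (t, y), K `<=` [set a | p.1 *: a - p.2 <> 0].
  apply: (cK _ (nbhs (t, y)) (fun p a => p.1 *: a - p.2 <> 0)) => a Ka.
  have cvga : (q.2.1 : R^o) *: q.1 - q.2.2 @[q --> (a, (t, y))]
      --> t *: a - y.
    apply: tlmod_cvgB; last by apply: cvg_comp; [exact: cvg_snd|exact: cvg_snd].
    apply: tlmod_cvgZ; last exact: cvg_fst.
    by apply: cvg_comp; [exact: cvg_snd|exact: cvg_fst].
  apply: (cvga (~` [set 0])); apply: open_nbhs_nbhs; split.
    by rewrite openC; exact/accessible_closed_set1/hausdorff_accessible.
  by move=> /subr0_eq tay; apply: tKy; exists a.
apply: filterS => p pK [a Ka pa]; apply: (pK a Ka); rewrite pa.
exact: subrr.
Qed.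

(** At [p.1 = 0] the homothety centered at [p.2] is the identity, which keeps [K] in [U];
    compactness of [K] spreads this to nearby ratios and centers. *)
Lemma near_homothety_compact_subset (K U : set V) (b : V) :
  compact K -> open U -> K `<=` U ->
  \forall p \near (0 : R^o, b), K `<=` [set a | U (a + p.1 *: (a - p.2))].
Proof.
move=> /compact_near_coveringP cK oU KU.
apply: (cK _ (nbhs (0 : R^o, b)) (fun p a => U (a + p.1 *: (a - p.2)))) => a Ka.
have cvga : q.1 + (q.2.1 : R^o) *: (q.1 - q.2.2) @[q --> (a, (0 : R^o, b))]
    --> a + 0 *: (a - b).
  apply: tlmod_cvgD; first exact: cvg_fst.
  apply: tlmod_cvgZ; first by apply: cvg_comp; [exact: cvg_snd|exact: cvg_fst].
  apply: tlmod_cvgB; first exact: cvg_fst.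
  by apply: cvg_comp; [exact: cvg_snd|exact: cvg_snd].
apply: (cvga U); rewrite scale0r addr0.
by apply: open_nbhs_nbhs; split => //; exact: KU.
Qed.

End TopologicalLmodule.

Section Correspondence.
Context {R : realType} {X Y : topologicalLmodType R}.
Variables (C : set X) (phi : X -> set Y).
Hypothesis coneC : is_cone C.
Hypothesis phi_compact : forall x, C x -> compact (phi x).
Hypothesis phi_lsc : forall x, C x -> corr_lsc_at C phi x.

Lemma lsc_rat_homogeneous_pos_homogeneous :
  hausdorff_space Y -> rat_homogeneous C phi -> pos_homogeneous C phi.
Proof.
move=> hY homQ.
have sub (t : R) x : 0 < t -> C x -> phi (t *: x) `<=` set_scale t (phi x).
  move=> t0 Cx y phiy; apply: contrapT.
  move=> /(near_notin_scale_compact _ _ _ hY (phi_compact _ Cx)).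
  move=> [[A B] /= [tA yB] AB].
  have cvgtx : (r : R^o) *: x @[r --> (t : R^o)] --> t *: x.
    by apply: tlmod_cvgZ; [exact: cvg_id|exact: cvg_cst].
  have phiB : phi (t *: x) `&` B° !=set0 by exists y; split.
  have /cvgtx nphi := phi_lsc _ (coneC _ _ t0 Cx) _ (open_interior B) phiB.
  (* A rational [r] in this set gives the contradiction: [phi (r *: x)] meets [B] by lower
     semicontinuity, yet equals [set_scale r (phi x)], which avoids [B] because [r] is in [A]. *)
  have nA : nbhs (t : R^o) (A `&` [set r | 0 < r] `&`
      [set r | C (r *: x) -> phi (r *: x) `&` B° !=set0]).
    by apply: filterI => //; apply: filterI => //; exact: lt_nbhsr.
  have [|r [/interior_subset[[Ar r0] Br] [q _ qr]]] :=
      @dense_rat R _ _ (open_interior (A `&` [set r | 0 < r] `&`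
      [set r | C (r *: x) -> phi (r *: x) `&` B° !=set0])).
    by exists t.
  have [z [phiz Bz]] := Br (coneC _ _ r0 Cx).
  apply: (AB (r, z)); first by split => //; exact: interior_subset.
  by rewrite /= -qr -homQ ?qr // -(ltr0q R) qr.
move=> t x t0 Cx; apply/seteqP; split; first exact: sub.
move=> _ [y phiy <-].
have [||a phia <-] := sub t^-1 (t *: x) _ (coneC _ _ t0 Cx) y.
- by rewrite invr_gt0.
- by rewrite scalerA mulVf ?gt_eqF// scale1r.
- by rewrite scalerA mulfV ?gt_eqF// scale1r.
Qed.

Hypothesis phi_sup : superadditive C phi.
Hypothesis phi_hom : pos_homogeneous C phi.

Lemma superadditive_lsc_usc_at (L : set X) (x0 : X) :
  C `<=` L ->
  (forall (s : R) x y, L x -> L y -> L (x + s *: (x - y))) ->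
  phi x0 !=set0 -> rel_interior L C x0 -> corr_usc_at C phi x0.
Proof.
move=> CL Lhom [b0 phib0] intx0.
have Cx0 : C x0 := nbhs_subspace_singleton intx0.
have Lx0 : L x0 := CL _ Cx0.
(* As [x0] is in [L], its neighborhoods in [subspace L] are the traces of those in [X]. *)
have {intx0}nC : within L (nbhs x0) C.
  by move: intx0; rewrite /rel_interior /interior /= nbhs_subspace_in.
move=> V oV phiV.
have [[A B] /= [A0 Bb0] AB] :=
  near_homothety_compact_subset _ _ b0 (phi_compact _ Cx0) oV phiV.
(* The ratio [s] is fixed before [x] varies: the factor [s^-1] in [w] is then constant, so [w] tends
   to [x0] with [x]. *)
have [s s0 As] : exists2 s : R, 0 < s & A s.
  have [e /= e0 eA] := (nbhs_ballP (0 : R^o) A).1 A0.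
  exists (e / 2); first by rewrite divr_gt0.
  apply: eA; rewrite /ball /= sub0r normrN gtr0_norm ?divr_gt0//.
  by rewrite ltr_pdivrMr// ltr_pMr// ltr1n.
have phiB : phi x0 `&` B° !=set0 by exists b0; split.
have nphi := phi_lsc _ Cx0 _ (open_interior B) phiB.
have cvgx0 : x0 + s^-1 *: (x0 - x) @[x --> x0] --> x0.
  rewrite -[X in _ --> X]addr0 -(scaler0 _ s^-1) -(subrr x0).
  apply: tlmod_cvgD; first exact: cvg_cst.
  apply: tlmod_cvgZ; first exact: cvg_cst.
  by apply: tlmod_cvgB; [exact: cvg_cst|exact: cvg_id].
have nw : \forall x \near x0, let w := x0 + s^-1 *: (x0 - x) in
    (L w -> C w) /\ (C w -> phi w `&` B° !=set0).
  exact: filterI (cvgx0 _ nC) (cvgx0 _ nphi).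
change (\forall x \near x0, C x -> phi x `<=` V).
apply: filterS nw => x [wC wB] Cx a phia.
set w := x0 + _ in wC wB.
(* Closeness to [x0] puts [w] in [C] only once [w] is known to lie in [L], which is why [L] must be
   stable under these homotheties. *)
have Cw : C w by apply: wC; apply: Lhom => //; exact: CL.
have [b [phib Bb]] := wB Cw.
have s10 : 0 < 1 + s by rewrite addr_gt0.
have xw : x + s *: w = (1 + s) *: x0.
  rewrite /w scalerDr scalerA mulfV ?gt_eqF// scale1r scalerDl scale1r.
  by rewrite addrCA [x + _]addrC subrK addrC.
have : phi ((1 + s) *: x0) (a + s *: b).
  rewrite -xw; apply: phi_sup => //; first exact: coneC.
  by exists a => //; exists (s *: b) => //; rewrite phi_hom//; exists b.
rewrite phi_hom// => -[c phic cab].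
(* Solving [(1 + s) *: c = a + s *: b] for [a] shows it to be the image of [c] under a homothety
   centered at [b], and [A] and [B] were chosen to keep such images in [V]. *)
have -> : a = c + s *: (c - b).
  by rewrite scalerBr addrA -{1}[c]scale1r -scalerDl cab addrK.
by apply: (AB (s, b)) => //=; split => //; exact: interior_subset.
Qed.

End Correspondence.

(** The two families are concatenated; [lin_span] allows repeated vectors, so overlaps need no
    merging. *)
Lemma lin_span_homothety {R : realType} {V : lmodType R} (E : set V) (s : R)
    (x y : V) :
  lin_span E x -> lin_span E y -> lin_span E (x + s *: (x - y)).
Proof.
move=> [m [v [c [Ev ->]]]] [n [w [d [Ew ->]]]].
exists (m + n)%N,
  (fun i => match fintype.split i with inl j => v j | inr j => w j end),
  (fun i => match fintype.split i with
            | inl j => (1 + s) * c j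
            | inr j => - s * d j
            end).
split; first by move=> i; case: fintype.split.
rewrite big_split_ord /=; set S := \sum_(i < m) _; set T := \sum_(i < n) _.
rewrite (eq_bigr (fun i => (1 + s) *: (c i *: v i))); last first.
  by move=> i _; rewrite (unsplitK (inl i)) scalerA.
rewrite [X in _ = _ + X](eq_bigr (fun i => - s *: (d i *: w i))); last first.
  by move=> i _; rewrite (unsplitK (inr i)) scalerA.
by rewrite -!scaler_sumr -/S -/T scalerDl scale1r scalerBr scaleNr addrA.
Qed.

Lemma conical_hull_sub_lin_span {R : realType} {V : lmodType R} (E : set V) :
  conical_hull E `<=` lin_span E.
Proof. by move=> x [m [v [c [Ev _ ->]]]]; exists m, v, c. Qed.

Theorem theorem2 (R : realType) (X : topologicalLmodType R)
    (hX : hausdorff_space X)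
    (C E : set X) (hC : is_convex_cone C) (hE : finite_cone_basis E C)
    (Y : topologicalLmodType R) (hY : hausdorff_space Y)
    (hYfin : finite_dimensional Y)
    (phi : X -> set Y) (hcc : cc_valued C phi)
    (hlsc : forall x, C x -> corr_lsc_at C phi x)
    (hhom : rat_homogeneous C phi) (hsup : superadditive C phi) :
  pos_homogeneous C phi /\
  (forall x, rel_interior (lin_span E) C x -> corr_continuous_at C phi x).
Proof.
have phi_compact x : C x -> compact (phi x) by move=> /hcc[].
have [coneC _] := hC; have [_ _ CE] := hE.
have hom : pos_homogeneous C phi.
  exact: lsc_rat_homogeneous_pos_homogeneous.
split=> // x intx; have Cx : C x := nbhs_subspace_singleton intx.
split; first exact: hlsc.
apply: (superadditive_lsc_usc_at _ _ coneC phi_compact hlsc hsup hom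
  (lin_span E)) => //.
- by rewrite CE; exact: conical_hull_sub_lin_span.
- exact: lin_span_homothety.
- by have [] := hcc _ Cx.
Qed.
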